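(* Let $f$ be strongly convex with parameter $\mu>0$ and have Lipschitz continuous gradient with parameter $L$ (both with respect to the $\pi$-norm), and let $\kappa=L/\mu$. Let $u^*=\mathcal I(x^* )$ be the coefficient sequence of the optimum $x^*$, let $u^*_m$ be the level $m$ optimum, and let $R_m=(\mathrm{Id}-P_m)u^*$. Then for every $m$, $$\|P_m(u^* )-u^*_m\|_2^2\le \kappa\,\|R_m\|_2^2 .$$ In particular $\|P_m(u^* )-u_m^*\|_2$ converges to zero, as $m\to\infty$, at a rate no slower than that of $\|R_m\|_2$.
   Context: Let $\pi$ be a probability measure on $\Theta\subset\mathbb R^d$ and $q\ge1$. $L^2_\pi$ is the space of ($\pi$-classes of) functions $x:\Theta\to\mathbb R^q$ with $\|x\|_\pi^2=\langle x,x\rangle_\pi<\infty$, where $\langle x,y\rangle_\pi=\int_\Theta x(\theta)\cdot y(\theta)\,\pi(d\theta)$. Fix an orthonormal basis $(B_i)_{i\ge1}$ of the real-valued square-integrable functions with respect to $\pi$. The isometric isomorphism $\mathcal I$ sends $x\in L^2_\pi$ to its coefficient sequence $u=(u_i)_{i\ge1}$, $u_i=\int_\Theta x(\theta)B_i(\theta)\pi(d\theta)\in\mathbb R^q$, in $l^2$ (with $\|u\|_2^2=\sum_i|u_i|^2$). $l^2_m$ is the set of $u\in l^2$ with $u_i=0$ for all $i>m$, $L^2_{\pi,m}$ is the corresponding set of functions, and $P_m$ is the projection of $l^2$ onto $l^2_m$ that sets $u_i=0$ for $i>m$. The objective is $f(x(\theta),\theta)$, differentiable in its first argument; $\nabla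 f$ is the gradient in the first argument, and $\nabla f(x(\cdot),\cdot)\in L^2_\pi$ for $x\in L^2_\pi$. Strong convexity with parameter $\mu$: $\langle \nabla f(x_1(\theta),\theta)-\nabla f(x_2(\theta),\theta),x_1(\theta)-x_2(\theta)\rangle_\pi\ge\mu\|x_1-x_2\|_\pi^2$ for all $x_1,x_2\in L^2_\pi$. Lipschitz gradient with parameter $L$: $\|\nabla f(x_1(\theta),\theta)-\nabla f(x_2(\theta),\theta)\|_\pi\le L\|x_1-x_2\|_\pi$ for all $x_1,x_2\in L^2_\pi$. The optimum $x^*\in L^2_\pi$ satisfies $\nabla f(x^*(\theta),\theta)=0$ for $\pi$-almost every $\theta$. The level $m$ optimum is the unique $u^*_m\in l^2_m$ such that, with $x^*_m\in L^2_{\pi,m}$ the function with coefficients $u^*_m$, the first $m$ basis coefficients of $\nabla f(x^*_m(\cdot),\cdot)$ vanish: $\int_\Theta\nabla f(x^*_m(\theta),\theta)B_i(\theta)\pi(d\theta)=0$ for $1\le i\le m$. *)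

(* Defs.v *)
From HB Require Import structures.
From mathcomp Require Import all_boot all_order all_algebra.
From mathcomp Require Import all_classical all_reals all_analysis.

Set Implicit Arguments.
Unset Strict Implicit.
Unset Printing Implicit Defensive.

Import Order.TTheory GRing.Theory Num.Theory.
Import numFieldNormedType.Exports.

Local Open Scope classical_set_scope.
Local Open Scope ring_scope.

(* The parameter space R^d is [d.-tuple R] (the product of Borel sigma-algebras
   is canonical on tuples); the decision space R^q is ['rV[R]_q] (a normed
   space, needed for differentiability).  The library norm `|v| on ['rV[R]_q] is
   the sup norm, so the Euclidean structure is introduced separately. *)

Definition dotv (R : realType) (q : nat) (v w : 'rV[R]_q) : R :=
  \sum_(j < q) v 0 j * w 0 j.

(* A probability measure on Theta \subset R^d is represented by a probability
   measure pi on R^d carried by Theta; functions on Theta are represented by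
   functions on R^d of which only the values on Theta matter. *)

Definition sq_integrable (R : realType) (d : nat)
    (pi : probability (d.-tuple R) R) (Theta : set (d.-tuple R))
    (g : d.-tuple R -> R) : Prop :=
  measurable_fun Theta g /\
  (\int[pi]_(t in Theta) ((g t) ^+ 2)%:E < +oo)%E.

(* Measurability into R^q is coordinatewise. *)
Definition L2 (R : realType) (d q : nat)
    (pi : probability (d.-tuple R) R) (Theta : set (d.-tuple R))
    (x : d.-tuple R -> 'rV[R]_q) : Prop :=
  (forall j : 'I_q, measurable_fun Theta (fun t => x t 0 j)) /\
  (\int[pi]_(t in Theta) (dotv (x t) (x t))%:E < +oo)%E.

Definition L2inner (R : realType) (d q : nat)
    (pi : probability (d.-tuple R) R) (Theta : set (d.-tuple R))
    (x y : d.-tuple R -> 'rV[R]_q) : R :=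
  Rintegral pi Theta (fun t => dotv (x t) (y t)).

Definition L2norm (R : realType) (d q : nat)
    (pi : probability (d.-tuple R) R) (Theta : set (d.-tuple R))
    (x : d.-tuple R -> 'rV[R]_q) : R :=
  Num.sqrt (L2inner pi Theta x x).

(* Indices start at 0: [B i] is the basis function B_{i+1}, and "i > m" for
   1-based indices becomes [(m <= i)%N]. *)
Definition orthonormal_basis (R : realType) (d : nat)
    (pi : probability (d.-tuple R) R) (Theta : set (d.-tuple R))
    (B : nat -> d.-tuple R -> R) : Prop :=
  [/\ forall i, sq_integrable pi Theta (B i),
      forall i j, Rintegral pi Theta (fun t => B i t * B j t) = (i == j)%:R
    & forall g, sq_integrable pi Theta g ->
        Rintegral pi Theta (fun t =>
          (g t - \sum_(i < n)
             Rintegral pi Theta (fun s => g s * B i s) * B i t) ^+ 2)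
        @[n --> \oo] --> (0 : R)].

(* The isometric isomorphism of L^2_pi onto l^2. *)
Definition coefs (R : realType) (d q : nat)
    (pi : probability (d.-tuple R) R) (Theta : set (d.-tuple R))
    (B : nat -> d.-tuple R -> R) (x : d.-tuple R -> 'rV[R]_q) :
    nat -> 'rV[R]_q :=
  fun i => \row_(j < q) Rintegral pi Theta (fun t => x t 0 j * B i t).

Definition l2 (R : realType) (q : nat) (u : nat -> 'rV[R]_q) : Prop :=
  cvgn (series (fun i => dotv (u i) (u i))).

(* Meaningful for sequences in [l2]. *)
Definition l2norm (R : realType) (q : nat) (u : nat -> 'rV[R]_q) : R :=
  Num.sqrt (limn (series (fun i => dotv (u i) (u i)))).

Definition l2m (R : realType) (q m : nat) (u : nat -> 'rV[R]_q) : Prop :=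
  l2 u /\ forall i, (m <= i)%N -> u i = 0.

Definition projm (R : realType) (q m : nat) (u : nat -> 'rV[R]_q) :
    nat -> 'rV[R]_q :=
  fun i => if (i < m)%N then u i else 0.

Definition grad (R : realType) (d q : nat)
    (f : 'rV[R]_q -> d.-tuple R -> R) (v : 'rV[R]_q) (t : d.-tuple R) :
    'rV[R]_q :=
  \row_(j < q) 'D_(delta_mx 0 j) (fun w => f w t) v.

Definition gradat (R : realType) (d q : nat)
    (f : 'rV[R]_q -> d.-tuple R -> R) (x : d.-tuple R -> 'rV[R]_q) :
    d.-tuple R -> 'rV[R]_q :=
  fun t => grad f (x t) t.

(* Standing assumptions on the objective.  Measurability of f in theta is what
   makes theta |-> f (x theta, theta) a random variable for measurable x, f
   being continuous in its first argument. *)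
Definition objective (R : realType) (d q : nat)
    (pi : probability (d.-tuple R) R) (Theta : set (d.-tuple R))
    (f : 'rV[R]_q -> d.-tuple R -> R) : Prop :=
  [/\ forall v, measurable_fun Theta (f v),
      forall t, Theta t -> forall v, differentiable (fun w => f w t) v
    & forall x, L2 pi Theta x -> L2 pi Theta (gradat f x)].

Definition strongly_convex (R : realType) (d q : nat)
    (pi : probability (d.-tuple R) R) (Theta : set (d.-tuple R))
    (f : 'rV[R]_q -> d.-tuple R -> R) (mu : R) : Prop :=
  forall x1 x2, L2 pi Theta x1 -> L2 pi Theta x2 ->
    mu * (L2norm pi Theta (x1 - x2)) ^+ 2
      <= L2inner pi Theta (gradat f x1 - gradat f x2) (x1 - x2).

Definition lipschitz_gradient (R : realType) (d q : nat)
    (pi : probability (d.-tuple R) R) (Theta : set (d.-tuple R))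
    (f : 'rV[R]_q -> d.-tuple R -> R) (L : R) : Prop :=
  forall x1 x2, L2 pi Theta x1 -> L2 pi Theta x2 ->
    L2norm pi Theta (gradat f x1 - gradat f x2)
      <= L * L2norm pi Theta (x1 - x2).

Definition optimum (R : realType) (d q : nat)
    (pi : probability (d.-tuple R) R) (Theta : set (d.-tuple R))
    (f : 'rV[R]_q -> d.-tuple R -> R) (x : d.-tuple R -> 'rV[R]_q) : Prop :=
  L2 pi Theta x /\ {ae pi, forall t, Theta t -> gradat f x t = 0}.

Definition level_optimum (R : realType) (d q : nat)
    (pi : probability (d.-tuple R) R) (Theta : set (d.-tuple R))
    (B : nat -> d.-tuple R -> R) (f : 'rV[R]_q -> d.-tuple R -> R)
    (m : nat) (u : nat -> 'rV[R]_q) : Prop :=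
  l2m m u /\
  exists x : d.-tuple R -> 'rV[R]_q,
    [/\ L2 pi Theta x, coefs pi Theta B x = u
      & forall i, (i < m)%N -> coefs pi Theta B (gradat f x) i = 0].

(* Main.v *)
(** A quasi-optimality bound with constant [kappa], rather than the [kappa ^ 2]
    available for a general monotone operator, needs the potential [f].  For
    fixed [x] and [y] in L^2, the first-order inequalities
    [<grad f x, y - x> + mu/2 |y - x|^2 <= f y - f x
       <= <grad f x, y - x> + L/2 |y - x|^2]
    hold at almost every theta.  Indeed the integrated hypotheses localise to
    almost every theta, because x1 and x2 may be exchanged on a measurable set,
    and the mean value point used to pass from gradients to values can be chosen
    measurably in theta, so that it defines again an element of L^2.

    Let x be the level m optimum and p the truncation of xstar.  Comparing f at
    xstar, x and p gives, almost everywhere,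
    [mu/2 |xstar - x|^2 + <grad f x, p - x> <= L/2 |xstar - p|^2].
    The middle term integrates to 0, since p - x lies in the span of the first m
    basis functions, and Parseval turns the rest into the claim. *)

Require Import Defs.
From HB Require Import structures.
From mathcomp Require Import all_boot all_order all_algebra.
From mathcomp Require Import all_classical all_reals all_analysis.
From mathcomp Require Import measurable_realfun ring lra.
Import Order.TTheory GRing.Theory Num.Theory.
Import numFieldNormedType.Exports.
Local Open Scope classical_set_scope.
Local Open Scope ring_scope.

Set Implicit Arguments.
Unset Strict Implicit.
Unset Printing Implicit Defensive.

(** * Mean value points found by bisection *)

Section bisection.
Context {R : realType}.
Implicit Types g : R -> R.

(** Left endpoint of the interval of length $2^{-n}$ left after [n] halvings of $[0,1]$. The test
    keeps the half over which [g] increases less. *)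
Fixpoint bisect g n : R :=
  if n is m.+1 then
    let a := bisect g m in let h := 2^-1 ^+ m.+1 in
    if g (a + h) *+ 2 <= g a + g (a + h *+ 2) then a else a + h
  else 0.

Lemma half_expr (n : nat) : 2^-1 ^+ n = (2^-1 ^+ n.+1) *+ 2 :> R.
Proof. by rewrite exprS; lra. Qed.

Lemma bisect_step g n :
  bisect g n <= bisect g n.+1 <= bisect g n + 2^-1 ^+ n.+1.
Proof.
have h0 : 0 <= 2^-1 ^+ n.+1 :> R by apply: exprn_ge0; lra.
by rewrite /=; case: ifP => _; lra.
Qed.

Lemma bisect_nondecreasing g : nondecreasing_seq (bisect g).
Proof. by apply/nondecreasing_seqP => n; case/andP: (bisect_step g n). Qed.

Lemma bisect_right_nonincreasing g :
  nonincreasing_seq (fun n => bisect g n + 2^-1 ^+ n).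
Proof.
apply/nonincreasing_seqP => n; have /andP[_] := bisect_step g n.
by rewrite (half_expr n); lra.
Qed.

(** The increments over the two halves add up to the increment over the whole, so the smaller one is
    at most half of it. *)
Lemma bisect_slope g n :
  g (bisect g n + 2^-1 ^+ n) - g (bisect g n) <= 2^-1 ^+ n * (g 1 - g 0).
Proof.
elim: n => [|n IHn]; first by rewrite /= expr0 add0r mul1r.
move: IHn => /=; rewrite (half_expr n).
set a := bisect g n; set h := 2^-1 ^+ n.+1; set c := g 1 - g 0.
have -> : h *+ 2 * c = (h * c) *+ 2 by rewrite mulrnAl.
case: ifPn => [|/negbTE/negbT]; first by lra.
rewrite -ltNge -addrA -mulr2n; by lra.
Qed.

Lemma bisect_le1 g n : bisect g n <= 1.
Proof.
have := bisect_right_nonincreasing g (leq0n n); rewrite /= expr0 add0r.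
by apply: le_trans; rewrite lerDl; apply: exprn_ge0; lra.
Qed.

Lemma is_cvg_bisect g : cvgn (bisect g).
Proof.
apply: nondecreasing_is_cvgn; first exact: bisect_nondecreasing.
by exists 1 => _ [n _ <-]; exact: bisect_le1.
Qed.

Lemma bisect_le_lim g n : bisect g n <= limn (bisect g).
Proof.
by apply: nondecreasing_cvgn_le;
  [exact: bisect_nondecreasing | exact: is_cvg_bisect].
Qed.

Lemma lim_bisect_le g n : limn (bisect g) <= bisect g n + 2^-1 ^+ n.
Proof.
apply: limr_le; first exact: is_cvg_bisect.
near=> k.
have nk : (n <= k)%N by near: k; exact: nbhs_infty_ge.
apply: le_trans (bisect_right_nonincreasing g nk).
by rewrite lerDl; apply: exprn_ge0; lra.
Unshelve. all: by end_near. Qed.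

(* Straddle lemma: the slopes over intervals shrinking to [s] and containing
   [s] converge to the derivative at [s]. *)
Lemma derive_le_straddle g (s l c : R) (a h : nat -> R) :
  is_derive s 1 g l -> (forall n, 0 < h n) -> h @ \oo --> (0 : R) ->
  (forall n, a n <= s <= a n + h n) ->
  (forall n, g (a n + h n) - g (a n) <= h n * c) -> l <= c.
Proof.
move=> [dg gl] h0 hcvg ash slope.
apply/ler_addgt0Pr => e e0.
have dcvg : h^-1 *: (g (h + s) - g s) @[h --> 0^'] --> l.
  have := dg; rewrite /derivable -gl /derive => /cvg_ex[l' hl'].
  rewrite (cvg_lim _ hl')//; apply: cvg_trans hl'; apply: near_eq_cvg.
  by near=> k; rewrite scaler1.
(* Clearing the denominator extends the estimate to [k = 0], needed because [s] may be an endpoint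
   of the intervals. *)
have near_s : \forall k \near (0 : R), `|g (k + s) - g s - k * l| <= e * `|k|.
  have /cvgrPdist_le/(_ e e0) := dcvg.
  rewrite near_withinE; apply: filterS => k Hk.
  have [->|k0] := eqVneq k 0.
    by rewrite add0r subrr mul0r subrr normr0 mulr0.
  have := Hk k0.
  rewrite -(ler_pM2r (x := `|k|)) ?normr_gt0// -normrM distrC; apply: le_trans.
  rewrite mulrBl [_^-1 *: _]mulrC -mulrA mulVf// mulr1 [l * k]mulrC.
  by rewrite opprB addrC.
have [del /= del0 Hdel] := near_s.
have [n hn] : exists n, h n < del.
  have /cvgrPdist_lt/(_ _ del0)[N _ HN] := hcvg.
  exists N; have := HN N (leqnn N) => /=.
  by rewrite sub0r normrN gtr0_norm.
have /andP[as_ sb] := ash n.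
(* The distances from [s] to the two endpoints add up to [h n], so the two expansion errors add up
   to at most [e * h n]. *)
have Ha := Hdel (a n - s); have Hb := Hdel (a n + h n - s).
rewrite /= !sub0r !normrN in Ha Hb.
have an : `|a n - s| = s - a n by rewrite ler0_norm; lra.
have bn : `|a n + h n - s| = a n + h n - s by rewrite ger0_norm; lra.
rewrite an bn !subrK in Ha Hb.
have {}Ha := Ha ltac:(lra); have {}Hb := Hb ltac:(lra).
move: Ha Hb; rewrite !ler_norml => /andP[_ Ha] /andP[Hb _].
have sl := slope n.
have : h n * l <= h n * (c + e) by lra.
by rewrite ler_pM2l.
Unshelve. all: by end_near. Qed.

End bisection.

(* The mean value point is found by bisection so that it depends measurably on
   the parameter. *)
Lemma measurable_mean_value_le {R : realType} {d : measure_display}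
    {T : measurableType d} (D : set T) (psi dpsi : T -> R -> R) :
  (forall a : T -> R, measurable_fun D a ->
     measurable_fun D (fun t => psi t (a t))) ->
  (forall t (s : R), D t -> is_derive s 1 (psi t) (dpsi t s)) ->
  exists s : T -> R, measurable_fun D s /\
    forall t, D t ->
      0 <= s t <= 1 /\ dpsi t (s t) <= psi t 1 - psi t 0.
Proof.
move=> mpsi dpsiE; exists (fun t => limn (bisect (psi t))); split.
  apply: (measurable_fun_cvg (h := fun n t => bisect (psi t) n)); last first.
    by move=> t Dt; exact: is_cvg_bisect.
  elim=> [|n IHn] /=; first exact: measurable_cst.
  move=> mD; move: (mD).
  have mpos k : measurable_fun D (fun t => bisect (psi t) n + k).
    by apply: measurable_funD => //; exact: measurable_cst.
  apply: measurable_fun_if => //.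
  - apply: measurable_fun_ler; last first.
      by apply: measurable_funD; exact: mpsi.
    under eq_fun do rewrite mulr2n.
    by apply: measurable_funD; exact: mpsi.
  - by apply: measurable_funS IHn.
  - by apply: measurable_funS (mpos _).
move=> t Dt; split.
  rewrite (bisect_le_lim _ 0)/= (le_trans (lim_bisect_le _ 0))//=.
  by rewrite expr0 add0r.
apply: (@derive_le_straddle _ (psi t) _ _ _ (bisect (psi t))
  (fun n => 2^-1 ^+ n)); first exact: dpsiE.
- by move=> n; apply: exprn_gt0; lra.
- by apply: cvg_expr; rewrite ger0_norm; lra.
- by move=> n; rewrite bisect_le_lim lim_bisect_le.
- by move=> n; exact: bisect_slope.
Qed.

(** * Measurability of superpositions *)

(* Caratheodory functions are superpositionally measurable: round the argument
   down to a grid, on which only countably many values occur. *)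
Lemma measurable_fun_caratheodory {R : realType} {d : measure_display}
    {T : measurableType d} (q : nat) (D : set T)
    (f : 'rV[R]_q -> T -> R) (x : T -> 'rV[R]_q) :
  (forall v, measurable_fun D (f v)) ->
  (forall t, D t -> continuous (f^~ t)) ->
  (forall j, measurable_fun D (fun t => x t 0 j)) ->
  measurable_fun D (fun t => f (x t) t).
Proof.
move=> mf cf mx.
pose grid n (k : 'rV[int]_q) : 'rV[R]_q := \row_j ((k 0 j)%:~R / n.+1%:R).
pose fl n (v : 'rV[R]_q) : 'rV[int]_q := \row_j Num.floor (n.+1%:R * v 0 j).
apply: (measurable_fun_cvg (h := fun n t => f (grid n (fl n (x t))) t)).
  move=> n mD Y mY.
  rewrite [X in measurable X](_ : _ = \bigcup_(k : 'rV[int]_q)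
    ((D `&` f (grid n k) @^-1` Y) `&` \bigcap_(j in [set: 'I_q])
       (D `&` (fun t => x t 0 j) @^-1`
          [set r | k 0 j = Num.floor (n.+1%:R * r)]))).
    apply: countable_bigcupT_measurable => // k.
    apply: measurableI; first exact: mf.
    apply: fin_bigcap_measurable => // j _; apply: mx => //.
    rewrite [X in measurable X](_ : _ =
      (fun r : R => n.+1%:R * r) @^-1` `[(k 0 j)%:~R, (k 0 j + 1)%:~R[).
      rewrite -[X in measurable X]setTI.
      by apply: mulrl_measurable => //; exact: measurable_itv.
    apply/seteqP; split=> r /=; rewrite in_itv /=.
      by move=> ->; exact: floor_itv.
    by move=> /floor_def ->.
  apply/seteqP; split=> t /=.
    move=> [Dt Yt]; exists (fl n (x t)) => //; split=> // j _; split=> //=.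
    by rewrite mxE.
  move=> [k _ [[Dt Yt] kE]]; split=> //.
  suff -> : fl n (x t) = k by [].
  by apply/rowP => j; rewrite mxE; case: (kE j I).
move=> t Dt.
suff gcvg : (fun n => grid n (fl n (x t))) @ \oo --> x t.
  exact: (cvg_comp _ _ gcvg (cf t Dt (x t))).
apply/cvgrPdist_le => e e0; near=> n.
rewrite /Num.norm /= mx_normrE; apply: bigmax_le => [|[i j] _]; first exact: ltW.
rewrite /= ord1 !mxE.
have n0 : 0 < n.+1%:R :> R by [].
have /andP[fl1 fl2] := floor_itv (n.+1%:R * x t 0 j).
(* Scaled by [n.+1], the rounding error is a fractional part, hence at most 1. *)
rewrite -(ler_pM2l n0) -[X in X * `|_|]gtr0_norm// -normrM mulrBr.
rewrite mulrCA divff ?gt_eqF// mulr1.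
rewrite ger0_norm ?subr_ge0// (@le_trans _ _ 1)//.
  by move: fl2; rewrite intrD; lra.
rewrite -ler_pdivrMl// mulr1; near: n.
have := @cvg_harmonic R => /cvgrPdist_le/(_ e e0).
by apply: filterS => n; rewrite sub0r normrN ger0_norm ?invr_ge0.
Unshelve. all: by end_near. Qed.

(** * Euclidean inner product on $\mathbb R^q$ *)

Section dotv.
Context {R : realType} {q : nat}.
Implicit Types (u v w : 'rV[R]_q) (c : R).

Lemma dotvC u v : dotv u v = dotv v u.
Proof. by apply: eq_bigr => j _; rewrite mulrC. Qed.

Lemma dotvDl u v w : dotv (u + v) w = dotv u w + dotv v w.
Proof. by rewrite -big_split; apply: eq_bigr => j _; rewrite mxE mulrDl. Qed.

Lemma dotvZl c u v : dotv (c *: u) v = c * dotv u v.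
Proof. by rewrite mulr_sumr; apply: eq_bigr => j _; rewrite mxE mulrA. Qed.

Lemma dotvNl u v : dotv (- u) v = - dotv u v.
Proof. by rewrite -scaleN1r dotvZl mulN1r. Qed.

Lemma dotvBl u v w : dotv (u - v) w = dotv u w - dotv v w.
Proof. by rewrite dotvDl dotvNl. Qed.

Lemma dotvDr u v w : dotv u (v + w) = dotv u v + dotv u w.
Proof. by rewrite dotvC dotvDl !(dotvC _ u). Qed.

Lemma dotvZr c u v : dotv u (c *: v) = c * dotv u v.
Proof. by rewrite dotvC dotvZl dotvC. Qed.

Lemma dotvNr u v : dotv u (- v) = - dotv u v.
Proof. by rewrite dotvC dotvNl dotvC. Qed.

Lemma dotv0l u : dotv 0 u = 0.
Proof. by rewrite -(scale0r 0) dotvZl mul0r. Qed.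

Lemma dotvN u : dotv (- u) (- u) = dotv u u.
Proof. by rewrite dotvNl dotvNr opprK. Qed.

Lemma dotv_ge0 u : 0 <= dotv u u.
Proof. by apply: sumr_ge0 => j _; rewrite -expr2 sqr_ge0. Qed.

Lemma sqr_le_dotv u j : u 0 j ^+ 2 <= dotv u u.
Proof.
rewrite /dotv (bigD1 j)//= -expr2 lerDl.
by apply: sumr_ge0 => i _; rewrite -expr2 sqr_ge0.
Qed.

End dotv.

(** * Square-integrable functions, scalar and vector valued *)

Section square_integrable.
Context {R : realType} {d : nat} (pi : probability (d.-tuple R) R).
Context (Theta : set (d.-tuple R)) (mTheta : measurable Theta).
Implicit Types g h : d.-tuple R -> R.

Local Notation intg g := (pi.-integrable Theta (EFin \o g)).
Local Notation sqi := (sq_integrable pi Theta).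
Local Notation "'int' g" := (Rintegral pi Theta g) (at level 10, g at level 9).

Lemma integrable_EFinD g h : intg g -> intg h -> intg (fun t => g t + h t).
Proof. by move=> ig ih; exact: (integrableD mTheta ig ih). Qed.

Lemma integrable_EFinB g h : intg g -> intg h -> intg (fun t => g t - h t).
Proof. by move=> ig ih; exact: (integrableB mTheta ig ih). Qed.

Lemma integrable_EFinZ c g : intg g -> intg (fun t => c * g t).
Proof. by move=> ig; exact: (integrableZl mTheta c ig). Qed.

Lemma integrable_EFin_sum (I : Type) (s : seq I) (g : I -> d.-tuple R -> R) :
  (forall i, intg (g i)) -> intg (fun t => \sum_(i <- s) g i t).
Proof.
move=> ig; elim: s => [|i s IHs].
  under eq_fun do rewrite big_nil; exact: integrable0.
by under eq_fun do rewrite big_cons; exact: integrable_EFinD.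
Qed.

Lemma Rintegral_sum (I : Type) (s : seq I) (g : I -> d.-tuple R -> R) :
  (forall i, intg (g i)) ->
  int (fun t => \sum_(i <- s) g i t) = \sum_(i <- s) int (g i).
Proof.
move=> ig; elim: s => [|i s IHs].
  under eq_Rintegral do rewrite big_nil.
  by rewrite big_nil Rintegral_cst// mul0r.
under eq_Rintegral do rewrite big_cons.
by rewrite RintegralD ?IHs ?big_cons//; exact: integrable_EFin_sum.
Qed.

Lemma Rintegral_ae_ge0 g : intg g ->
  {ae pi, forall t, Theta t -> 0 <= g t} -> 0 <= int g.
Proof.
move=> ig g0; have mg := measurable_int _ ig.
(* The integrand agrees almost everywhere with its positive part, which is nonnegative at every
   point. *)
rewrite /Rintegral (ae_eq_integral (EFin \o (fun t => Num.max (g t) 0)))//.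
- apply: fine_ge0; apply: integral_ge0 => t _ /=.
  by rewrite lee_fin le_max lexx orbT.
- apply/measurable_EFinP/measurable_maxr; last exact: measurable_cst.
  exact/measurable_EFinP.
- by apply: filterS g0 => t + Tt => /(_ Tt) gt0 /=; congr EFin; rewrite max_l.
Qed.

(** The negative part [Num.min (g t) 0] is nonpositive with nonnegative integral, so its absolute
    value integrates to 0 and it vanishes almost everywhere. *)
Lemma ae_ge0_of_Rintegral_min g : intg g ->
  0 <= int (fun t => Num.min (g t) 0) ->
  {ae pi, forall t, Theta t -> 0 <= g t}.
Proof.
move=> ig gE; have mg := measurable_int _ ig.
have mm : measurable_fun Theta (EFin \o (fun t => Num.min (g t) 0)).
  apply/measurable_EFinP/measurable_minr; last exact: measurable_cst.
  exact/measurable_EFinP.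
have im : intg (fun t => Num.min (g t) 0).
  apply: (le_integrable mTheta _ _ ig) => // t _ /=.
  rewrite lee_fin; case: (ltP (g t) 0) => // _.
  by rewrite normr0.
have : ae_eq pi Theta (EFin \o (fun t => Num.min (g t) 0)) (cst 0%E).
  apply/(ae_eq_integral_abs _ mTheta mm).
  have iNm := integrable_EFinZ (-1) im.
  have Nm0 t : 0 <= -1 * Num.min (g t) 0.
    by rewrite mulN1r oppr_ge0 ge_min lexx orbT.
  transitivity (\int[pi]_(t in Theta) (-1 * Num.min (g t) 0)%:E)%E.
    apply: eq_integral => t _ /=; congr EFin.
    by rewrite mulN1r ler0_norm// -oppr_ge0 -mulN1r.
  rewrite -(fineK (integrable_fin_num mTheta iNm)); congr EFin.
  apply/eqP; rewrite eq_le; apply/andP; split; last exact: Rintegral_ge0.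
  have := RintegralZl (-1) mTheta im; rewrite /Rintegral /= => ->.
  by rewrite mulN1r oppr_le0.
apply: filterS => t + Tt => /(_ Tt) /= [] mt.
by rewrite leNgt; apply/negP => gt0; move: mt; rewrite min_l ?ltW// => /eqP;
  rewrite lt_eqF.
Qed.

Lemma integrable_sqr g : sqi g -> intg (fun t => g t ^+ 2).
Proof.
move=> [mg gfin]; apply/integrableP; split.
  exact/measurable_EFinP/measurable_funX.
under eq_integral do rewrite /= ger0_norm ?sqr_ge0//.
exact: gfin.
Qed.

Lemma sq_integrable_of_sqr g : measurable_fun Theta g ->
  intg (fun t => g t ^+ 2) -> sqi g.
Proof. by move=> mg ig; split=> //; exact: (integrable_lty mTheta ig). Qed.

Lemma le_sq_integrable g h : measurable_fun Theta g -> sqi h ->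
  (forall t, Theta t -> `|g t| <= `|h t|) -> sqi g.
Proof.
move=> mg sh gh; apply: sq_integrable_of_sqr => //.
apply: (le_integrable mTheta _ _ (integrable_sqr sh)).
  exact/measurable_EFinP/measurable_funX.
move=> t Tt /=; rewrite lee_fin !normrX.
by apply: lerXn2r; rewrite ?nnegrE//; exact: gh.
Qed.

(** Dominated by $|gh|\le g^2+h^2$. *)
Lemma integrable_mul g h : sqi g -> sqi h -> intg (fun t => g t * h t).
Proof.
move=> sg sh; have ig := integrable_sqr sg; have ih := integrable_sqr sh.
apply: (le_integrable mTheta _ _ (integrable_EFinD ig ih)).
  by apply/measurable_EFinP/measurable_funM; [case: sg|case: sh].
move=> t _ /=; rewrite lee_fin [leRHS]ger0_norm ?addr_ge0 ?sqr_ge0//.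
by rewrite ler_norml; apply/andP; split; nra.
Qed.

Lemma sq_integrableD g h : sqi g -> sqi h -> sqi (fun t => g t + h t).
Proof.
move=> sg sh; apply: sq_integrable_of_sqr.
  by apply: measurable_funD; [case: sg|case: sh].
have -> : (fun t => (g t + h t) ^+ 2) =
    (fun t => (g t ^+ 2 + h t ^+ 2) + 2 * (g t * h t)).
  by apply/funext => t; ring.
apply: integrable_EFinD; last exact/integrable_EFinZ/integrable_mul.
by apply: integrable_EFinD; exact: integrable_sqr.
Qed.

Lemma sq_integrableZ c g : sqi g -> sqi (fun t => c * g t).
Proof.
move=> sg; apply: sq_integrable_of_sqr.
  by apply: measurable_funM; [exact: measurable_cst|case: sg].
under eq_fun do rewrite exprMn.
exact/integrable_EFinZ/integrable_sqr.
Qed.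

Lemma sq_integrableB g h : sqi g -> sqi h -> sqi (fun t => g t - h t).
Proof.
move=> sg sh; under eq_fun do rewrite -mulN1r.
exact/sq_integrableD/sq_integrableZ.
Qed.

Lemma sq_integrable_sum (I : Type) (s : seq I) (g : I -> d.-tuple R -> R) :
  (forall i, sqi (g i)) -> sqi (fun t => \sum_(i <- s) g i t).
Proof.
move=> sg; elim: s => [|i s IHs].
  under eq_fun do rewrite big_nil.
  apply: sq_integrable_of_sqr; first exact: measurable_cst.
  by under eq_fun do rewrite expr0n; exact: integrable0.
by under eq_fun do rewrite big_cons; exact: sq_integrableD.
Qed.

Context {q : nat}.
Implicit Types x y : d.-tuple R -> 'rV[R]_q.
Local Notation L2 := (@L2 R d q pi Theta).

(** Reduces vector-valued claims to scalar ones: the squared Euclidean norm dominates each squared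
    coordinate and is their finite sum. *)
Lemma L2P x : L2 x <-> forall j, sqi (fun t => x t 0 j).
Proof.
split=> [[mx xfin] j|sx].
  split=> //; apply: le_lt_trans xfin; apply: ge0_le_integral => //=.
  - by move=> t _; rewrite lee_fin sqr_ge0.
  - exact/measurable_EFinP/measurable_funX.
  - apply/measurable_EFinP/measurable_sum => i.
    exact: measurable_funM.
  - by move=> t _; rewrite lee_fin sqr_le_dotv.
split=> [j|]; first by case: (sx j).
apply: (integrable_lty mTheta).
by apply: integrable_EFin_sum => j; exact: integrable_mul.
Qed.

Lemma L2_dotv_integrable x y : L2 x -> L2 y -> intg (fun t => dotv (x t) (y t)).
Proof.
move=> /L2P sx /L2P sy.
by apply: integrable_EFin_sum => j; exact: integrable_mul.
Qed.

Lemma L2D x y : L2 x -> L2 y -> L2 (x + y).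
Proof.
move=> /L2P sx /L2P sy; apply/L2P => j.
by under eq_fun do rewrite mxE; exact: sq_integrableD.
Qed.

Lemma L2B x y : L2 x -> L2 y -> L2 (x - y).
Proof.
move=> /L2P sx /L2P sy; apply/L2P => j.
by under eq_fun do rewrite !mxE; exact: sq_integrableB.
Qed.

(** Serves twice: with [s] an indicator, to exchange two functions on a measurable set, and with [s]
    a mean value point, to move along the segment between two functions. *)
Lemma L2_scale_fun (s : d.-tuple R -> R) x : measurable_fun Theta s ->
  (forall t, Theta t -> 0 <= s t <= 1) -> L2 x -> L2 (fun t => s t *: x t).
Proof.
move=> ms s01 /L2P sx; apply/L2P => j.
under eq_fun do rewrite mxE.
apply: (le_sq_integrable _ (sx j)).
  by apply: measurable_funM => //; case: (sx j).
move=> t /s01/andP[s0 s1].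
by rewrite normrM ger0_norm// ler_piMl.
Qed.

Lemma L2norm_sqr x : L2norm pi Theta x ^+ 2 = L2inner pi Theta x x.
Proof. by rewrite sqr_sqrtr//; apply: Rintegral_ge0 => t _; exact: dotv_ge0. Qed.

(** The right side minus the left is $k\,\|y-k^{-1}x\|_\pi^2$. A suitable weight [k] lets this
    replace the Cauchy-Schwarz inequality. *)
Lemma L2inner_young (k : R) x y : 0 < k -> L2 x -> L2 y ->
  2 * L2inner pi Theta x y
    <= k * L2inner pi Theta y y + k^-1 * L2inner pi Theta x x.
Proof.
move=> k0 Lx Ly; rewrite /L2inner -!RintegralZl//; try exact: L2_dotv_integrable.
rewrite -RintegralD//; try exact/integrable_EFinZ/L2_dotv_integrable.
apply: le_Rintegral => //; first exact/integrable_EFinZ/L2_dotv_integrable.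
  by apply: integrable_EFinD; exact/integrable_EFinZ/L2_dotv_integrable.
move=> t _; rewrite -subr_ge0.
suff -> : k * dotv (y t) (y t) + k^-1 * dotv (x t) (x t) - 2 * dotv (x t) (y t)
    = k * dotv (y t - k^-1 *: x t) (y t - k^-1 *: x t).
  by apply: mulr_ge0; [exact: ltW|exact: dotv_ge0].
rewrite !(dotvDl, dotvDr, dotvNl, dotvNr, dotvZl, dotvZr) (dotvC (y t) (x t)).
by field; rewrite gt_eqF.
Qed.

End square_integrable.

(** * Gradients and derivatives along lines *)

(** [grad] only collects partial derivatives; differentiability makes the derivative linear in the
    direction, so [z] can be expanded in the canonical basis. *)
Lemma derive_dotv_grad {R : realType} {d q : nat}
    (f : 'rV[R]_q -> d.-tuple R -> R) (t : d.-tuple R) (p z : 'rV[R]_q) :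
  differentiable (fun w => f w t) p ->
  'D_z (fun w => f w t) p = dotv (grad f p t) z.
Proof.
move=> df; rewrite deriveE// [in LHS](row_sum_delta z) linear_sum /=.
by apply: eq_bigr => j _; rewrite linearZ /= mxE deriveE// mulrC.
Qed.

Lemma is_derive_line {R : realType} {d q : nat}
    (f : 'rV[R]_q -> d.-tuple R -> R) (t : d.-tuple R) (v z : 'rV[R]_q) (s : R) :
  differentiable (fun w => f w t) (v + s *: z) ->
  is_derive s 1 (fun r => f (v + r *: z) t) (dotv (grad f (v + s *: z) t) z).
Proof.
set F := fun w => f w t; move=> dF.
have lineE : (fun h : R => h^-1 *: (F (v + (h *: 1 + s) *: z) - F (v + s *: z)))
    = (fun h : R => h^-1 *: (F (h *: z + (v + s *: z)) - F (v + s *: z))).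
  apply/funext => h; congr (_ *: (F _ - _)).
  by rewrite scaler1 scalerDl addrCA.
split.
- have := diff_derivable (v := z) dF; rewrite /derivable -lineE; exact.
- by rewrite -derive_dotv_grad// /derive -lineE.
Qed.

(** * From integrated gradient inequalities to pointwise first-order bounds *)

Section first_order.
Context {R : realType} {d q : nat} (pi : probability (d.-tuple R) R).
Context (Theta : set (d.-tuple R)) (mTheta : measurable Theta).
Context (f : 'rV[R]_q -> d.-tuple R -> R) (hf : objective pi Theta f).
Implicit Types x y : d.-tuple R -> 'rV[R]_q.

(** One expression for both hypotheses: its integral is nonnegative for [k = 1], [c = mu] by strong
    convexity, and for [k = -1], [c = - L] by the upper bound that the Lipschitz gradient gives. *)
Local Notation gap k c x y := (fun t =>
  k * dotv (gradat f x t - gradat f y t) (x t - y t)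
  - c * dotv (x t - y t) (x t - y t)).

Lemma gap_integrable k c x y : L2 pi Theta x -> L2 pi Theta y ->
  pi.-integrable Theta (EFin \o gap k c x y).
Proof.
have [_ _ Lgrad] := hf; move=> Lx Ly.
have Lxy := L2B mTheta Lx Ly.
have Lg := L2B mTheta (Lgrad _ Lx) (Lgrad _ Ly).
apply: integrable_EFinB => //; apply: integrable_EFinZ => //;
  exact: L2_dotv_integrable.
Qed.

Context (k c : R) (gap_ge0 : forall x y, L2 pi Theta x -> L2 pi Theta y ->
  0 <= Rintegral pi Theta (gap k c x y)).

(* The integrated inequality localises: test it against the function that
   equals [x] where the integrand is negative, and [y] elsewhere. *)
Lemma ae_gap_ge0 x y : L2 pi Theta x -> L2 pi Theta y ->
  {ae pi, forall t, Theta t -> 0 <= gap k c x y t}.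
Proof.
move=> Lx Ly; have ig := gap_integrable k c Lx Ly.
apply: (ae_ge0_of_Rintegral_min mTheta ig).
pose e t : R := if gap k c x y t < 0 then 1 else 0.
pose x' : d.-tuple R -> 'rV[R]_q := y + (fun t => e t *: (x - y) t).
have Lx' : L2 pi Theta x'.
  apply: L2D => //; apply: L2_scale_fun => //; last exact: L2B.
    move=> mD; move: (mD); apply: measurable_fun_if => //.
    apply: measurable_fun_ltr => //.
    by apply/measurable_EFinP; exact: (measurable_int _ ig).
  by move=> t _; rewrite /e; case: ifP; rewrite lexx ler01.
have := gap_ge0 Lx' Ly.
(* Where [x'] equals [y] the gap is zero, so the gap of [x'] and [y] is the negative part of the gap
   of [x] and [y]. *)
rewrite (@eq_Rintegral _ _ _ _ _ (fun t => Num.min (gap k c x y t) 0))//.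
move=> t _; have x'E : x' t = if gap k c x y t < 0 then x t else y t.
  rewrite /x' fctE /e; case: ifP => _; last by rewrite scale0r addr0.
  by rewrite scale1r addrC !fctE subrK.
rewrite /gradat x'E; case: (ltP (gap k c x y t) 0) => // _.
by rewrite !subrr !dotv0l !mulr0 subrr.
Qed.

(** Along the segment from [x] to [y], [psi] is the difference of the two sides up to a constant,
    and [s * dpsi t s] is the gap between [x + s z] and [x]. The localised inequality has an
    exceptional null set depending on the pair of functions, so it cannot be used for all [s] at
    once. It is applied once, at the function [y'] given by measurable mean value points. *)
Lemma ae_first_order_ge x y : L2 pi Theta x -> L2 pi Theta y ->
  {ae pi, forall t, Theta t ->
     c / 2 * dotv (y t - x t) (y t - x t) <=
     k * (f (y t) t - f (x t) t - dotv (gradat f x t) (y t - x t))}.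
Proof.
have [mf df Lgrad] := hf; move=> Lx Ly.
pose z : d.-tuple R -> 'rV[R]_q := y - x.
have Lz : L2 pi Theta z by exact: L2B.
pose psi t (s : R) := k * (f (x t + s *: z t) t - s * dotv (gradat f x t) (z t))
  - c / 2 * dotv (z t) (z t) * s ^+ 2.
pose dpsi t s := k * (dotv (grad f (x t + s *: z t) t) (z t)
  - dotv (gradat f x t) (z t)) - c * dotv (z t) (z t) * s.
have mdot u v : L2 pi Theta u -> L2 pi Theta v ->
    measurable_fun Theta (fun t => dotv (u t) (v t : 'rV[R]_q)).
  move=> Lu Lv; apply/measurable_EFinP.
  exact: (measurable_int _ (L2_dotv_integrable mTheta Lu Lv)).
have [||s [ms sP]] := @measurable_mean_value_le R _ _ Theta psi dpsi.
- move=> a ma; apply: measurable_funB; last first.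
    apply: measurable_funM; last exact: measurable_funX.
    by apply: measurable_funM; [exact: measurable_cst|exact: mdot].
  apply: measurable_funM; first exact: measurable_cst.
  apply: measurable_funB; last first.
    by apply: measurable_funM => //; apply: mdot => //; exact: Lgrad.
  apply: (measurable_fun_caratheodory (f := f)
    (x := fun t => x t + a t *: z t)) => //.
    by move=> t Tt v; exact/differentiable_continuous/df.
  move=> j; under eq_fun do rewrite mxE [X in _ + X]mxE.
  have [mx _] := Lx; have [mz _] := Lz.
  by apply: measurable_funD => //; apply: measurable_funM => //; exact: mz.
- move=> t s Tt.
  have dline := @is_derive_line R d q f t (x t) (z t) s (df t Tt _).
  have -> : psi t = k \*: ((fun r => f (x t + r *: z t) t)
      - dotv (gradat f x t) (z t) \*: id)
      - (c / 2 * dotv (z t) (z t)) \*: (id ^+ 2).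
    by apply/funext => r; rewrite /psi !fctE /= [_ *: r]mulrC.
  apply: is_derive_eq; rewrite /dpsi /= expr1 /GRing.scale /=.
  by field.
pose y' : d.-tuple R -> 'rV[R]_q := x + (fun t => s t *: z t).
have Ly' : L2 pi Theta y'.
  by apply: L2D => //; apply: L2_scale_fun => // t /sP[].
apply: filterS (ae_gap_ge0 Ly' Lx) => t + Tt => /(_ Tt).
have [/andP[s0 _] sle] := sP t Tt.
have -> : y' t - x t = s t *: z t by rewrite /y' fctE addrAC subrr add0r.
rewrite dotvZr dotvZl dotvZr dotvBl => gap0.
have : 0 <= s t * dpsi t (s t).
  apply: le_trans gap0 _; rewrite le_eqVlt; apply/orP; left; apply/eqP.
  by rewrite /dpsi /gradat /y' fctE; ring.
have psiE : psi t 1 - psi t 0 =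
    k * (f (y t) t - f (x t) t - dotv (gradat f x t) (z t))
    - c / 2 * dotv (z t) (z t).
  rewrite /psi scale1r scale0r addr0 addrC -/(z t).
  rewrite [x t + z t]addrC /z !fctE subrK.
  by ring.
move=> sd; rewrite psiE in sle; rewrite -subr_ge0; apply: le_trans sle.
(* The factor [s t] cannot be cancelled when it is 0, but there [dpsi] vanishes outright. *)
have [s0'|s0'] := eqVneq (s t) 0.
  by rewrite s0' /dpsi scale0r addr0 subrr !mulr0 subrr.
by move: sd; rewrite pmulr_rge0// lt_neqAle eq_sym s0'.
Qed.

End first_order.

(** * Square-summable sequences and their tails *)

Section l2_sequences.
Context {R : realType} {q : nat}.
Implicit Types u v : nat -> 'rV[R]_q.

Lemma l2norm_sqr u : l2 u ->
  l2norm u ^+ 2 = limn (series (fun i => dotv (u i) (u i))).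
Proof.
move=> lu; rewrite sqr_sqrtr//; apply: limr_ge => //.
by apply: nearW => n; apply: sumr_ge0 => i _; exact: dotv_ge0.
Qed.

Lemma l2_projm u m : l2 u -> l2 (projm m u).
Proof.
apply: series_le_cvg => i; [exact: dotv_ge0|exact: dotv_ge0|].
by rewrite /projm; case: ifP => // _; rewrite dotv0l dotv_ge0.
Qed.

Lemma l2norm_projm_le u m : l2 u -> l2norm (projm m u) ^+ 2 <= l2norm u ^+ 2.
Proof.
move=> lu; have lp : l2 (projm m u) := l2_projm lu; rewrite !l2norm_sqr//.
apply: (lim_series_le lp lu) => i.
by rewrite /projm; case: ifP => // _; rewrite dotv0l dotv_ge0.
Qed.

(** The squared norm of the tail is the full sum minus the partial sum of the first [m] terms. *)
Lemma cvg_l2norm_tail u : l2 u ->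
  l2norm (u - projm m u) @[m --> \oo] --> (0 : R).
Proof.
move=> lu; pose a i := dotv (u i) (u i).
have tE m i : (u - projm m u) i = u i - projm m u i by [].
have tailE m : limn (series (fun i =>
    dotv ((u - projm m u) i) ((u - projm m u) i))) =
    limn (series a) - series a m.
  apply: cvg_lim => //.
  apply: (@cvg_trans _ ((series a n - series a m) @[n --> \oo])).
    apply: near_eq_cvg; near=> n.
    have mn : (m <= n)%N by near: n; exact: nbhs_infty_ge.
    rewrite sub_series_geq// /series /= [RHS](big_cat_nat (leq0n m) mn)/=.
    rewrite [X in _ = X + _]big_nat [X in _ = X + _]big1 ?add0r.
      by apply: eq_big_nat => i /andP[mi _]; rewrite tE /projm ltnNge mi subr0.
    by move=> i /andP[_ im]; rewrite tE /projm im subrr dotv0l.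
  by apply: cvgB; [exact: lu|exact: cvg_cst].
rewrite /l2norm; under eq_cvg do rewrite tailE.
have tail0 : limn (series a) - series a m @[m --> \oo] --> (0 : R).
  rewrite -[X in _ --> X](subrr (limn (series a))).
  by apply: cvgB; [exact: cvg_cst|exact: lu].
have := cvg_comp _ _ tail0 (@sqrt_continuous R 0); rewrite sqrtr0; exact.
Unshelve. all: by end_near. Qed.

End l2_sequences.

(** * Basis coefficients, Parseval's identity and finite combinations *)

Section basis.
Context {R : realType} {d : nat} (pi : probability (d.-tuple R) R).
Context (Theta : set (d.-tuple R)) (mTheta : measurable Theta).
Context (B : nat -> d.-tuple R -> R) (hB : orthonormal_basis pi Theta B).

Local Notation sqi := (sq_integrable pi Theta).
Local Notation "'int' g" := (Rintegral pi Theta g) (at level 10, g at level 9).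

Lemma sq_integrable_basis i : sqi (B i).
Proof. by have [] := hB. Qed.

Lemma sq_integrable_combination n (c : nat -> R) :
  sqi (fun t => \sum_(i < n) c i * B i t).
Proof.
apply: sq_integrable_sum => // i; apply: sq_integrableZ => //.
exact: sq_integrable_basis.
Qed.

Lemma Rintegral_combination n (c : nat -> R) g : sqi g ->
  int (fun t => g t * \sum_(i < n) c i * B i t) =
  \sum_(i < n) c i * int (fun t => g t * B i t).
Proof.
move=> sg; under eq_Rintegral do rewrite mulr_sumr.
have igB i : pi.-integrable Theta (EFin \o (fun t => g t * B i t)).
  by apply: integrable_mul => //; exact: sq_integrable_basis.
under eq_Rintegral do under eq_bigr do rewrite mulrCA.
rewrite Rintegral_sum//; last by move=> i; exact: integrable_EFinZ.
by apply: eq_bigr => i _; rewrite RintegralZl.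
Qed.

Lemma Rintegral_combination_basis n (c : nat -> R) k :
  int (fun t => (\sum_(i < n) c i * B i t) * B k t) =
  if (k < n)%N then c k else 0.
Proof.
have [_ ortho _] := hB.
under eq_Rintegral do rewrite mulrC.
rewrite Rintegral_combination; last exact: sq_integrable_basis.
under eq_bigr do rewrite ortho.
case: ifPn => [kn|]; last first.
  rewrite -leqNgt => nk; apply: big1 => i _.
  by rewrite gtn_eqF ?mulr0// (leq_trans (ltn_ord i)).
rewrite (bigD1 (Ordinal kn))//= eqxx mulr1 big1 ?addr0// => i ik.
by rewrite eq_sym (negbTE ik : (i == k :> nat) = false) mulr0.
Qed.

(** Expanding the square, orthonormality makes the squared residual after [n] terms equal to
    $\|g\|^2$ minus the partial sum of squared coefficients; completeness sends that residual to
    0. *)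
Lemma parseval g : sqi g ->
  series (fun i => int (fun t => g t * B i t) ^+ 2) @ \oo
    --> int (fun t => g t ^+ 2).
Proof.
move=> sg; have [_ _ complete] := hB.
pose c i := int (fun t => g t * B i t).
have resE n : int (fun t => (g t - \sum_(i < n) c i * B i t) ^+ 2) =
    int (fun t => g t ^+ 2) - series (fun i => c i ^+ 2) n.
  have sS := sq_integrable_combination n c.
  have ig := integrable_sqr sg; have iS := integrable_sqr sS.
  have igS := integrable_mul mTheta sg sS.
  under eq_Rintegral => t _.
    have -> : (g t - \sum_(i < n) c i * B i t) ^+ 2 =
      (g t ^+ 2 + (\sum_(i < n) c i * B i t) ^+ 2)
      - 2 * (g t * \sum_(i < n) c i * B i t) by ring.
    over.
  rewrite RintegralB//; [|exact: integrable_EFinD|exact: integrable_EFinZ].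
  rewrite RintegralD// RintegralZl//.
  rewrite (Rintegral_combination n c sg) (Rintegral_combination n c sS).
  rewrite seriesEord /=.
  have -> : \sum_(i < n)
        c i * int (fun t => (\sum_(i0 < n) c i0 * B i0 t) * B i t)
      = \sum_(i < n) c i ^+ 2.
    by apply: eq_bigr => i _; rewrite Rintegral_combination_basis ltn_ord expr2.
  under [X in 2 * X]eq_bigr do rewrite -/(c _) -expr2.
  by ring.
rewrite -[X in _ --> X]subr0.
have -> : series (fun i => c i ^+ 2) = fun n =>
    int (fun t => g t ^+ 2)
    - int (fun t => (g t - \sum_(i < n) c i * B i t) ^+ 2).
  by apply/funext => n; rewrite resE opprB addrC subrK.
by apply: cvgB; [exact: cvg_cst|exact: complete].
Qed.

Context {q : nat}.
Implicit Types (x y : d.-tuple R -> 'rV[R]_q) (u e : nat -> 'rV[R]_q).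
Local Notation L2 := (L2 pi Theta).
Local Notation coefs := (coefs pi Theta B).

Lemma vector_parseval x : L2 x ->
  series (fun i => dotv (coefs x i) (coefs x i)) @ \oo --> L2inner pi Theta x x.
Proof.
move=> /(L2P _ mTheta) sx.
have -> : L2inner pi Theta x x = \sum_(j < q) int (fun t => x t 0 j ^+ 2).
  by rewrite /L2inner /dotv Rintegral_sum// => j; exact: integrable_mul.
have -> : series (fun i => dotv (coefs x i) (coefs x i)) = fun n =>
    \sum_(j < q) series (fun i => int (fun t => x t 0 j * B i t) ^+ 2) n.
  apply/funext => n; rewrite /series /= exchange_big /=; apply: eq_bigr => i _.
  by apply: eq_bigr => j _; rewrite !mxE expr2.
apply: cvg_big => [|j _]; last exact: parseval.
exact: add_continuous.
Qed.

Lemma l2_coefs x : L2 x -> l2 (coefs x).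
Proof. by move=> /vector_parseval Lx; apply/cvg_ex; eexists; exact: Lx. Qed.

Lemma l2norm_coefs x : L2 x -> l2norm (coefs x) ^+ 2 = L2inner pi Theta x x.
Proof.
move=> Lx; rewrite l2norm_sqr; last exact: l2_coefs.
exact/cvg_lim/vector_parseval.
Qed.

Lemma coefs_integrable x i j : L2 x ->
  pi.-integrable Theta (EFin \o (fun t => x t 0 j * B i t)).
Proof.
move=> /(L2P _ mTheta) sx; apply: integrable_mul => //.
exact: sq_integrable_basis.
Qed.

Lemma coefsB x y : L2 x -> L2 y -> coefs (x - y) = coefs x - coefs y.
Proof.
move=> Lx Ly; apply/funext => i; apply/rowP => j; rewrite !fctE !mxE.
rewrite -RintegralB//; try exact: coefs_integrable.
by apply: eq_Rintegral => t _; rewrite !mxE mulrBl.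
Qed.

Lemma coefsD x y : L2 x -> L2 y -> coefs (x + y) = coefs x + coefs y.
Proof.
move=> Lx Ly; apply/funext => i; apply/rowP => j; rewrite !fctE !mxE.
rewrite -RintegralD//; try exact: coefs_integrable.
by apply: eq_Rintegral => t _; rewrite !mxE mulrDl.
Qed.

(** The inverse of [coefs] on level [m], as an explicit finite combination with vector
    coefficients. *)
Definition synthesis m e : d.-tuple R -> 'rV[R]_q :=
  fun t => \row_j \sum_(i < m) e i 0 j * B i t.

Lemma L2_synthesis m e : L2 (synthesis m e).
Proof.
apply/L2P => // j; under eq_fun do rewrite mxE.
exact: (sq_integrable_combination m (fun i => e i 0 j)).
Qed.

Lemma coefs_synthesis m e : coefs (synthesis m e) = projm m e.
Proof.
apply/funext => i; apply/rowP => j; rewrite !mxE.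
under eq_Rintegral do rewrite mxE.
rewrite (Rintegral_combination_basis m (fun i => e i 0 j)) /projm.
by case: ifP => // _; rewrite mxE.
Qed.

(** Turns the vanishing of the first [m] coefficients of a gradient into orthogonality to every
    level [m] function. *)
Lemma L2inner_synthesis m e x : L2 x ->
  L2inner pi Theta x (synthesis m e) = \sum_(i < m) dotv (coefs x i) (e i).
Proof.
move=> /(L2P _ mTheta) sx.
rewrite /L2inner /dotv Rintegral_sum//; last first.
  move=> j; apply: integrable_mul => //.
  by have /(L2P _ mTheta) := L2_synthesis m e.
rewrite exchange_big /=; apply: eq_bigr => j _.
under eq_Rintegral do rewrite mxE.
rewrite (Rintegral_combination m (fun i => e i 0 j))//.
by apply: eq_bigr => i _; rewrite mxE mulrC.
Qed.

End basis.

(** * Error of the level m optimum *)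

Section level_optimum.
Context {R : realType} {d q : nat} (pi : probability (d.-tuple R) R).
Context (Theta : set (d.-tuple R)) (mTheta : measurable Theta).
Context (f : 'rV[R]_q -> d.-tuple R -> R) (hf : objective pi Theta f).
Context (mu L : R) (hmu : 0 < mu) (hconv : strongly_convex pi Theta f mu)
  (hlip : lipschitz_gradient pi Theta f L).
Implicit Types x y : d.-tuple R -> 'rV[R]_q.

(** For [L > 0] this is Young's inequality with weight [L]: the Lipschitz bound gives
    $L^{-1}\|a\|^2\le L\|b\|^2$, so both terms on the right are at most $L\|b\|^2$. *)
Lemma lipschitz_gradient_inner x y : L2 pi Theta x -> L2 pi Theta y ->
  L2inner pi Theta (gradat f x - gradat f y) (x - y)
    <= L * L2inner pi Theta (x - y) (x - y).
Proof.
have [_ _ Lgrad] := hf; move=> Lx Ly.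
have La := L2B mTheta (Lgrad _ Lx) (Lgrad _ Ly).
have Lb := L2B mTheta Lx Ly.
have := hlip Lx Ly; have := hconv Lx Ly.
set a := gradat f x - gradat f y; set b := x - y.
rewrite -L2norm_sqr.
have N0 : 0 <= L2norm pi Theta a by exact: sqrtr_ge0.
have M0 : 0 <= L2norm pi Theta b by exact: sqrtr_ge0.
have young k : 0 < k -> _ := fun k0 => L2inner_young mTheta k0 La Lb.
rewrite -/a -/b -!L2norm_sqr in young.
move: (L2norm pi Theta a) (L2norm pi Theta b) N0 M0 young.
move=> N M N0 M0 young cX NM.
have [L0|L0] := ltP 0 L.
  have := young L L0.
  have : L^-1 * N ^+ 2 <= L * M ^+ 2.
    rewrite ler_pdivrMl// mulrA -expr2 -exprMn.
    by apply: lerXn2r; rewrite ?nnegrE// mulr_ge0// ltW.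
  by lra.
(* Here [a = 0] in L^2, so strong convexity forces [b = 0]. *)
have N00 : N = 0.
  by apply/eqP; rewrite eq_le N0 andbT (le_trans NM)// mulr_le0_ge0.
(* Young with weight [mu] now reads $2\langle a,b\rangle\le\mu\|b\|^2$, while strong convexity gives
   $\mu\|b\|^2\le\langle a,b\rangle$. *)
have := young mu hmu; rewrite N00 expr0n /= mulr0 addr0 => X2.
have M2 : mu * M ^+ 2 <= 0 by lra.
have M20 : M ^+ 2 = 0.
  by apply/eqP; rewrite eq_le sqr_ge0 andbT -(pmulr_rle0 _ hmu).
by move: X2; rewrite M20 !mulr0; lra.
Qed.

Lemma ae_strongly_convex x y : L2 pi Theta x -> L2 pi Theta y ->
  {ae pi, forall t, Theta t ->
     dotv (gradat f x t) (y t - x t)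
       + mu / 2 * dotv (y t - x t) (y t - x t) <= f (y t) t - f (x t) t}.
Proof.
have [_ _ Lgrad] := hf; move=> Lx Ly.
have gap0 x1 x2 : L2 pi Theta x1 -> L2 pi Theta x2 ->
    0 <= Rintegral pi Theta (fun t =>
      1 * dotv (gradat f x1 t - gradat f x2 t) (x1 t - x2 t)
      - mu * dotv (x1 t - x2 t) (x1 t - x2 t)).
  move=> Lx1 Lx2.
  have Lb := L2B mTheta Lx1 Lx2.
  have La := L2B mTheta (Lgrad _ Lx1) (Lgrad _ Lx2).
  have ib := L2_dotv_integrable mTheta Lb Lb.
  have iab := L2_dotv_integrable mTheta La Lb.
  rewrite RintegralB ?RintegralZl//; [|exact: (integrable_EFinZ mTheta)..].
  by rewrite mul1r subr_ge0 -/(L2inner pi Theta _ _) -L2norm_sqr; exact: hconv.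
apply: filterS (ae_first_order_ge mTheta hf gap0 Lx Ly) => t + Tt => /(_ Tt).
by lra.
Qed.

Lemma ae_smooth x y : L2 pi Theta x -> L2 pi Theta y ->
  {ae pi, forall t, Theta t ->
     f (y t) t - f (x t) t <= dotv (gradat f x t) (y t - x t)
       + L / 2 * dotv (y t - x t) (y t - x t)}.
Proof.
have [_ _ Lgrad] := hf; move=> Lx Ly.
have gap0 x1 x2 : L2 pi Theta x1 -> L2 pi Theta x2 ->
    0 <= Rintegral pi Theta (fun t =>
      -1 * dotv (gradat f x1 t - gradat f x2 t) (x1 t - x2 t)
      - - L * dotv (x1 t - x2 t) (x1 t - x2 t)).
  move=> Lx1 Lx2.
  have Lb := L2B mTheta Lx1 Lx2.
  have La := L2B mTheta (Lgrad _ Lx1) (Lgrad _ Lx2).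
  have ib := L2_dotv_integrable mTheta Lb Lb.
  have iab := L2_dotv_integrable mTheta La Lb.
  rewrite RintegralB ?RintegralZl//; [|exact: (integrable_EFinZ mTheta)..].
  rewrite mulN1r mulNr opprK addrC subr_ge0.
  exact: lipschitz_gradient_inner.
apply: filterS (ae_first_order_ge mTheta hf gap0 Lx Ly) => t + Tt => /(_ Tt).
by lra.
Qed.

Context (B : nat -> d.-tuple R -> R) (hB : orthonormal_basis pi Theta B).
Context (xstar : d.-tuple R -> 'rV[R]_q) (hxstar : optimum pi Theta f xstar).

Local Notation ustar := (coefs pi Theta B xstar).

Lemma level_optimum_error m u : level_optimum pi Theta B f m u ->
  mu * l2norm (projm m ustar - u) ^+ 2
    <= L * l2norm (ustar - projm m ustar) ^+ 2.
Proof.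
have [_ _ Lgrad] := hf; have [Lxs gs0] := hxstar.
move=> [[_ u0] [x [Lx xu gx0]]].
pose w := synthesis B m (ustar - u).
have Lw : L2 pi Theta w by exact: L2_synthesis.
(* [p] is the truncation of [xstar], written so that [p - x] is an explicit
   combination of the first [B i], to which the gradient at [x] is orthogonal. *)
pose p := x + w.
have Lp : L2 pi Theta p by exact: L2D.
have Lxx := L2B mTheta Lxs Lx; have Lxp := L2B mTheta Lxs Lp.
have gw0 : L2inner pi Theta (gradat f x) w = 0.
  rewrite L2inner_synthesis//; last exact: Lgrad.
  by apply: big1 => i _; rewrite gx0 ?dotv0l.
have tail : ustar - projm m ustar = coefs pi Theta B (xstar - p).
  rewrite coefsB// coefsD// coefs_synthesis// xu.
  apply/funext => i; rewrite !fctE /projm; case: ltnP => im.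
    by rewrite [u i + _]addrC subrK.
  by rewrite (u0 _ im) addr0.
(* As [u] vanishes from index [m] on, the error is a truncation of the coefficients of [xstar - x],
   and is bounded below by their full norm. *)
have head : projm m ustar - u = projm m (coefs pi Theta B (xstar - x)).
  rewrite coefsB// xu; apply/funext => i; rewrite !fctE /projm.
  by case: ltnP => // im; rewrite (u0 _ im) subr0.
rewrite tail head l2norm_coefs//.
have /(_ m) bessel := fun m => l2norm_projm_le m (l2_coefs mTheta hB Lxx).
apply: (@le_trans _ _ (mu * L2inner pi Theta (xstar - x) (xstar - x))).
  by rewrite ler_pM2l// -(l2norm_coefs mTheta hB).
have ixx := L2_dotv_integrable mTheta Lxx Lxx.
have ixp := L2_dotv_integrable mTheta Lxp Lxp.
have igw := L2_dotv_integrable mTheta (Lgrad _ Lx) Lw.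
suff : 0 <= Rintegral pi Theta (fun t =>
    L / 2 * dotv ((xstar - p) t) ((xstar - p) t)
    - mu / 2 * dotv ((xstar - x) t) ((xstar - x) t)
    - dotv (gradat f x t) (w t)).
  rewrite RintegralB//; last first.
    by apply: integrable_EFinB => //; exact: integrable_EFinZ.
  rewrite RintegralB ?RintegralZl//; [|exact: integrable_EFinZ..].
  rewrite -!/(L2inner pi Theta _ _) gw0.
  by lra.
apply: Rintegral_ae_ge0 => //.
  apply: integrable_EFinB => //.
  by apply: integrable_EFinB => //; exact: integrable_EFinZ.
(* Strong convexity bounds [f x - f xstar] and [f p - f x] from below, and smoothness bounds their
   sum [f p - f xstar] from above. The values of [f] cancel, the gradient at [xstar] is 0, and the
   leftover [mu / 2 * |w|^2] is dropped as nonnegative. *)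
apply: filterS2 (filterI gs0 (ae_strongly_convex Lxs Lx))
  (filterI (ae_strongly_convex Lx Lp) (ae_smooth Lxs Lp)) => t.
move=> [gs convs] [convx smooths] Tt.
have pE : p t - x t = w t by rewrite /p fctE addrC addKr.
have xxE : (xstar - x) t = - (x t - xstar t) by rewrite opprB.
have xpE : (xstar - p) t = - (p t - xstar t) by rewrite opprB.
move: (convs Tt) (convx Tt) (smooths Tt).
rewrite (gs Tt) !dotv0l pE xxE xpE !dotvN.
have w0 : 0 <= mu / 2 * dotv (w t) (w t).
  by apply: mulr_ge0; [by rewrite divr_ge0 ?ltW|exact: dotv_ge0].
by lra.
Qed.

End level_optimum.

(** * The bound with constant [kappa] and the convergence rate *)

Theorem lemma3p1 (R : realType) (d q : nat) (hq : (1 <= q)%N)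
    (Theta : set (d.-tuple R)) (mTheta : measurable Theta)
    (pi : probability (d.-tuple R) R) (piTheta : pi Theta = 1%E)
    (B : nat -> d.-tuple R -> R) (hB : orthonormal_basis pi Theta B)
    (f : 'rV[R]_q -> d.-tuple R -> R) (hf : objective pi Theta f)
    (mu L : R) (hmu : 0 < mu)
    (hconv : strongly_convex pi Theta f mu)
    (hlip : lipschitz_gradient pi Theta f L)
    (xstar : d.-tuple R -> 'rV[R]_q) (hxstar : optimum pi Theta f xstar)
    (um : nat -> nat -> 'rV[R]_q)
    (hum : forall m, level_optimum pi Theta B f m (um m)) :
  let kappa := L / mu in
  let ustar := coefs pi Theta B xstar in
  let Rm := fun m : nat => ustar - projm m ustar in
  let err := fun m : nat => l2norm (projm m ustar - um m) in
  [/\ forall m, (err m) ^+ 2 <= kappa * (l2norm (Rm m)) ^+ 2,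
      err m @[m --> \oo] --> (0 : R)
    & err =O_\oo (fun m => l2norm (Rm m))].
Proof.
move=> kappa ustar Rm err.
have err2 m : err m ^+ 2 <= kappa * l2norm (Rm m) ^+ 2.
  rewrite /kappa mulrAC ler_pdivlMr// mulrC.
  exact: (level_optimum_error mTheta hf hmu hconv hlip hB hxstar (hum m)).
have err0 m : 0 <= err m by exact: sqrtr_ge0.
have Rm0 m : 0 <= l2norm (Rm m) by exact: sqrtr_ge0.
have err1 m : err m <= Num.sqrt kappa * l2norm (Rm m).
  rewrite -[leLHS]ger0_norm// -sqrtr_sqr (le_trans (ler_wsqrtr (err2 m)))//.
  (* The square root is split at the squared norm, whose sign is known, rather than at [kappa]. *)
  by rewrite mulrC sqrtrM ?sqr_ge0// sqrtr_sqr ger0_norm// mulrC.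
split=> //.
  apply: (@squeeze_cvgr _ _ _ _ (cst 0)
    (fun m => Num.sqrt kappa * l2norm (Rm m))).
  - by apply: nearW => m; rewrite err0 err1.
  - exact: cvg_cst.
  rewrite -[X in _ --> X](mulr0 (Num.sqrt kappa)).
  apply: cvgM; first exact: cvg_cst.
  apply: cvg_l2norm_tail; apply: l2_coefs => //.
  by case: hxstar.
(* The added 1 makes the constant strictly positive, [Num.sqrt kappa] being only known to be
   nonnegative. *)
apply/eqO_exP; exists (Num.sqrt kappa + 1).
  by rewrite ltr_wpDl// sqrtr_ge0.
apply: nearW => m; rewrite !ger0_norm// (le_trans (err1 m))//.
by rewrite ler_wpM2r// lerDl.
Qed.
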